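(* Let $1\le S\le N$ be integers, let $\mathbf{V}\in\mathbb{C}^{N\times S}$ have orthonormal columns $\mathbf{v}_1,\dots,\mathbf{v}_S$ (the first $S$ right singular vectors of a channel matrix $\mathbf H$), and let $\mathbb{V}=\{\hat{\mathbf V}_1,\dots,\hat{\mathbf V}_C\}$ be a finite codebook of matrices in $\mathbb{C}^{N\times S}$ with orthonormal columns, the $k$-th column of $\hat{\mathbf V}_i$ being denoted $\hat{\mathbf v}_{ik}$. Let $\mathbb{D}$ be the set of all $S\times S$ diagonal unitary matrices. For each $i$, define $$\mathbf{D}^{opt}_i=\mathrm{diag}\left(e^{j\theta^{opt}_{1}},\dots,e^{j\theta^{opt}_{S}}\right),\qquad \theta_k^{opt}=-\phi_k,\quad k=1,\dots,S,$$ where $0\le\phi_k<2\pi$ is the phase of the complex number $\hat{\mathbf v}_{ik}^H\mathbf v_k$, i.e. $\hat{\mathbf v}_{ik}^H\mathbf v_k=|\hat{\mathbf v}_{ik}^H\mathbf v_k|e^{j\phi_k}$ (so $\phi_k$ and $\theta_k^{opt}$ depend on $i$). Then the problem of selecting a codebook element by the joint minimization $$\min_{\hat{\mathbf V}_i\in\mathbb{V},\ \mathbf D\in\mathbb{D}}\ \|\mathbf{V}\mathbf{D}-\hat{\mathbf V}_i\|_F^2$$ is equivalent to the problem $$\min_{\hat{\mathbf V}_i\in\mathbb{V}}\ \|\mathbf{V}\mathbf{D}^{opt}_i-\hat{\mathbf V}_i\|_F^2 ,$$ in the sense that an element $\hat{\mathbf V}_i\in\mathbb V$ is the codebook component of some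 minimizer $(\hat{\mathbf V}_i,\mathbf D)$ of the first problem if and only if it is a minimizer of the second problem.
   Context: $\|\cdot\|_F$ is the Frobenius norm, $(\cdot)^H$ is the conjugate transpose, and $j$ is the imaginary unit. If $\hat{\mathbf v}_{ik}^H\mathbf v_k=0$, its phase $\phi_k$ may be taken to be any value in $[0,2\pi)$. *)

(* Defs.v *)
From HB Require Import structures.
From mathcomp Require Import all_boot all_order all_algebra.
From mathcomp Require Import complex.
From mathcomp Require Import boolp classical_sets reals trigo.

Set Implicit Arguments.
Unset Strict Implicit.
Unset Printing Implicit Defensive.

Import Order.TTheory GRing.Theory Num.Theory.
Import Normc.

Local Open Scope sesquilinear_scope.
Local Open Scope complex_scope.
Local Open Scope classical_set_scope.
Local Open Scope ring_scope.

Definition normF (R : realType) (m n : nat) (A : 'M[R[i]]_(m, n)) : R :=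
  Num.sqrt (\sum_(a < m) \sum_(b < n) normc (A a b) ^+ 2).

(* [unitarymx] asks for orthonormal rows ([X *m X^t* = 1%:M]). *)
Definition orthonormal_cols (R : realType) (m n : nat)
    (A : 'M[R[i]]_(m, n)) : Prop :=
  A^t* *m A = 1%:M.

Definition diag_unitary (R : realType) (n : nat) : set 'M[R[i]]_n :=
  [set D | is_diag_mx D /\ D \is unitarymx].

(* [u^H v] *)
Definition hdot (R : realType) (n : nat) (u v : 'cV[R[i]]_n) : R[i] :=
  (u^t* *m v) 0 0.

(* [e^(j t)] *)
Definition expi (R : realType) (t : R) : R[i] := cos t +i* sin t.

(* When [z = 0], every [t] in [0, 2 pi) qualifies. *)
Definition is_phase (R : realType) (z : R[i]) (t : R) : Prop :=
  0 <= t < 2 * pi /\ z = `|z| * expi t.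

Definition diag_expi (R : realType) (n : nat) (theta : 'I_n -> R) :
    'M[R[i]]_n :=
  diag_mx (\row_k expi (theta k)).

Definition is_minimizer (R : realType) (T : Type) (A : set T) (f : T -> R)
    (x : T) : Prop :=
  A x /\ forall y, A y -> f x <= f y.

(* Main.v *)
(* For a diagonal unitary D = diag(d), expanding the square gives
   |V D - W|^2 = |V|^2 + |W|^2 - 2 sum_k Re (d_k w_k^H v_k), and each summand is
   at most |w_k^H v_k|, with equality when d_k cancels the phase of w_k^H v_k.
   So for each codebook entry the inner minimum over D is reached at D^opt. *)
Require Import Defs.
From HB Require Import structures.
From mathcomp Require Import all_boot all_order all_algebra.
From mathcomp Require Import complex.
From mathcomp Require Import boolp classical_sets reals trigo.
From mathcomp Require Import ring.

Import Order.TTheory GRing.Theory Num.Theory Normc.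

Local Open Scope complex_scope.
Local Open Scope classical_set_scope.
Local Open Scope ring_scope.

Lemma normc_sqr (R : rcfType) (z : R[i]) :
  normc z ^+ 2 = complex.Re z ^+ 2 + complex.Im z ^+ 2.
Proof. by case: z => a b; rewrite sqr_sqrtr // addr_ge0 ?sqr_ge0. Qed.

Lemma normc_mul_conjc (R : rcfType) (z : R[i]) : z * z^*%C = (normc z ^+ 2)%:C.
Proof.
rewrite normc_sqr; case: z => a b; apply/eqP; rewrite eq_complex /=.
by apply/andP; split; apply/eqP; ring.
Qed.

(** Polarization, with [y] as the conjugated factor so that the cross terms of a column add up to
    [hdot]. *)
Lemma normc_sqrB (R : rcfType) (x y : R[i]) :
  normc (x - y) ^+ 2 =
  normc x ^+ 2 + normc y ^+ 2 - 2 * complex.Re (y^*%C * x).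
Proof. by rewrite !normc_sqr; case: x y => [a b] [c d] /=; ring. Qed.

Lemma Re_le_normc (R : rcfType) (z : R[i]) : complex.Re z <= normc z.
Proof.
apply: le_trans (ler_norm _) _; case: z => a b /=.
by rewrite -sqrtr_sqr ler_wsqrtr // lerDl sqr_ge0.
Qed.

Lemma Re_sum (R : rcfType) (I : Type) (r : seq I) (P : pred I) (F : I -> R[i]) :
  complex.Re (\sum_(k <- r | P k) F k) = \sum_(k <- r | P k) complex.Re (F k).
Proof. by apply: (big_morph (@complex.Re R)) => // -[a b] [c d]. Qed.

Lemma normc_expi (R : realType) (t : R) : normc (expi t) = 1.
Proof. by rewrite /= cos2Dsin2 sqrtr1. Qed.

Lemma expiNM (R : realType) (t : R) : expi (- t) * expi t = 1.
Proof.
apply/eqP; rewrite eq_complex /= cosN sinN.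
apply/andP; split; apply/eqP; last by ring.
by rewrite -(cos2Dsin2 t); ring.
Qed.

(** The equality case of [Re_le_normc]: turning [z] back by its phase leaves the nonnegative real
    [|z|]. Only the polar form is used, so [z = 0] is covered for every [t]. *)
Lemma Re_expiN_phase (R : realType) (z : R[i]) (t : R) :
  is_phase z t -> complex.Re (expi (- t) * z) = normc z.
Proof.
by move=> [_ ez]; rewrite ez mulrCA expiNM mulr1 normcM normc_expi mulr1; case: (z) => a b /=;
  rewrite expr0n addr0 sqrtr_sqr ger0_norm ?sqrtr_ge0.
Qed.

(** The product of [diag_mx d] with its adjoint is diagonal with entries [|d_k|^2], so unitarity
    decouples into one condition per entry. *)
Lemma diag_unitaryE (R : realType) (n : nat) (d : 'rV[R[i]]_n) :
  diag_unitary (diag_mx d) <-> forall k, normc (d 0 k) = 1.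
Proof.
have E : diag_mx d *m map_mx Num.conj (diag_mx d)^T
    = diag_mx (\row_k (normc (d 0 k) ^+ 2)%:C).
  rewrite tr_diag_mx map_diag_mx mulmx_diag; congr diag_mx.
  by apply/rowP => k; rewrite !mxE -normc_mul_conjc.
split=> [[_ /unitarymxP] | h].
  rewrite E => /matrixP h k; move/eqP: (h k k).
  rewrite !mxE eqxx mulr1n eq_complex /= => /andP[+ _].
  by rewrite sqrp_eq1 ?sqrtr_ge0 => [/eqP //|]; case: (d 0 k) => a b; apply: sqrtr_ge0.
split; first exact: diag_mx_is_diag.
apply/unitarymxP; rewrite E -diag_const_mx; congr diag_mx.
by apply/rowP => k; rewrite !mxE h expr1n.
Qed.

Lemma diag_expi_unitary (R : realType) (n : nat) (theta : 'I_n -> R) :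
  diag_unitary (diag_expi theta).
Proof. by apply/diag_unitaryE => k; rewrite mxE normc_expi. Qed.

(** The column sum is outermost because right multiplication by a diagonal matrix scales each column
    separately. *)
Lemma normF_sqr (R : realType) (m n : nat) (A : 'M[R[i]]_(m, n)) :
  normF A ^+ 2 = \sum_b \sum_a normc (A a b) ^+ 2.
Proof.
rewrite sqr_sqrtr; first exact: exchange_big.
by apply: sumr_ge0 => a _; apply: sumr_ge0 => b _; apply: sqr_ge0.
Qed.

Lemma normF_sqr_diagB (R : realType) (m n : nat) (V W : 'M[R[i]]_(m, n))
    (d : 'rV[R[i]]_n) : (forall k, normc (d 0 k) = 1) ->
  normF (V *m diag_mx d - W) ^+ 2 =
  normF V ^+ 2 + normF W ^+ 2
  - 2 * \sum_k complex.Re (d 0 k * hdot (col k W) (col k V)).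
Proof.
move=> d1; rewrite !normF_sqr mulr_sumr -sumrN -!big_split; apply: eq_bigr => k _ /=.
rewrite /hdot mxE mulr_sumr Re_sum mulr_sumr -sumrN -!big_split; apply: eq_bigr => a _ /=.
(* Since [|d_k| = 1], scaling preserves the modulus of each entry of [V]; [d] survives only in the
   cross term. *)
rewrite mul_mx_diag !mxE normc_sqrB normcM d1 mulr1.
by rewrite [d 0 k * _]mulrCA [d 0 k * _]mulrC.
Qed.

Lemma normF_phase_min (R : realType) (m n : nat) (V W : 'M[R[i]]_(m, n))
    (phi : 'I_n -> R) (D : 'M[R[i]]_n) :
  (forall k, is_phase (hdot (col k W) (col k V)) (phi k)) ->
  diag_unitary D ->
  normF (V *m diag_expi (fun k => - phi k) - W) ^+ 2
  <= normF (V *m D - W) ^+ 2.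
Proof.
move=> hphi hD; case: (hD) => /diag_mxP [d eD] _; move: hD.
rewrite {}eD => /diag_unitaryE d1.
rewrite !normF_sqr_diagB //; last by move=> k; rewrite mxE normc_expi.
(* The constant parts agree and the sign reverses the order, so it suffices that the phases
   [- phi k] maximize each cross term separately. *)
rewrite lerD2l lerN2 ler_pM2l ?ltr0n //; apply: ler_sum => k _.
rewrite mxE Re_expiN_phase //.
by rewrite (le_trans (Re_le_normc _ _)) // normcM d1 mul1r.
Qed.

Theorem proposition1 (R : realType) (N S C : nat)
  (hS : (1 <= S)%N) (hSN : (S <= N)%N)
  (V : 'M[R[i]]_(N, S)) (hV : orthonormal_cols V)
  (Vhat : 'I_C -> 'M[R[i]]_(N, S))
  (hVhat : forall i : 'I_C, orthonormal_cols (Vhat i))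
  (phi : 'I_C -> 'I_S -> R)
  (hphi : forall (i : 'I_C) (k : 'I_S),
     is_phase (hdot (col k (Vhat i)) (col k V)) (phi i k)) :
  let Dopt := fun i : 'I_C => diag_expi (fun k : 'I_S => - phi i k) in
  forall i : 'I_C,
    (exists D : 'M[R[i]]_S,
       is_minimizer (range Vhat `*` @diag_unitary R S)
         (fun p => normF (V *m p.2 - p.1) ^+ 2) (Vhat i, D))
    <->
    is_minimizer [set: 'I_C]
      (fun l => normF (V *m Dopt l - Vhat l) ^+ 2) i.
Proof.
move=> Dopt i.
have optU l : diag_unitary (Dopt l) by exact: diag_expi_unitary.
have optmin l D : diag_unitary D ->
    normF (V *m Dopt l - Vhat l) ^+ 2 <= normF (V *m D - Vhat l) ^+ 2.
  by move=> hD; apply: normF_phase_min.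
split=> [[D [[_ /= hD] hmin]] | [_ hmin]].
  split=> // l _; apply: (le_trans (optmin i D hD)).
  (* Joint minimality is tested against entry [l] paired with its own optimal phases. *)
  by apply: (hmin (Vhat l, Dopt l)); split; [exists l | exact: optU].
exists (Dopt i); split; first by split; [exists i | exact: optU].
(* A competing matrix is traded for any index [l] producing it; repeated codebook entries do no
   harm, since [optmin] holds at every index. *)
move=> [_ D] [[l _ /= <-] hD] /=.
exact: le_trans (hmin l I) (optmin l D hD).
Qed.
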